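(* Let $n \ge k \ge 1$ be integers and let $s_1,\ldots,s_n \in [0,1]$ be scores of $n$ candidates, $S = \sum_{i=1}^n s_i$. Consider the following procedure (the offline algorithm for linear utility): if $S = k$, set $p_i = s_i$; if $S < k$, set $p_i = \min\{s_i + b, 1\}$ where $b \ge 0$ is chosen so that $\sum_i p_i = k$; if $S > k$, set $p_i = \max\{s_i - b, 0\}$ where $b \ge 0$ is chosen so that $\sum_i p_i = k$. Then select a random set of candidates by a dependent rounding procedure that, given $p_1,\ldots,p_n\in[0,1]$ with $\sum_i p_i = k$, outputs a random set of exactly $k$ candidates containing each candidate $i$ with probability exactly $p_i$. Then this procedure outputs a cohort of exactly $k$ candidates in which candidate $i$ is selected with marginal probability $p_i$, these marginals satisfy $|p_i - p_j| \le |s_i - s_j|$ for all $i,j$, and $$\sum_{i=1}^n p_i s_i = \max\Big\{ \sum_{i=1}^n q_i s_i \;:\; q \in [0,1]^n,\ \sum_{i=1}^n q_i = k,\ |q_i - q_j| \le |s_i - s_j| \ \forall i,j \Big\}.$$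
   Context: The fairness-preserving cohort selection problem: given scores $s_i$ from a classifier for $n$ candidates, select a (random) cohort of exactly $k$ candidates such that the marginal selection probabilities $p_i$ satisfy $|p_i - p_j| \le |s_i - s_j|$ for all pairs $i,j$. The linear utility of such a selection is $\sum_i p_i s_i$. *)

(* Defs.v *)
From HB Require Import structures.
From mathcomp Require Import all_boot all_order all_algebra.
From mathcomp Require Import classical_sets reals.

Set Implicit Arguments.
Unset Strict Implicit.
Unset Printing Implicit Defensive.

Import Order.TTheory GRing.Theory Num.Theory.
Local Open Scope ring_scope.
Local Open Scope classical_set_scope.

Record fdist (R : realType) (T : finType) := FDist {
  pmf :> {ffun T -> R};
  pmf_ge0 : forall x, 0 <= pmf x;
  pmf_sum1 : \sum_x pmf x = 1
}.

(* The law of a random set of candidates is an fdist on {set 'I_n}. *)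
Definition selection_prob (R : realType) (n : nat)
    (D : fdist R {set 'I_n}) (i : 'I_n) : R :=
  \sum_(C : {set 'I_n} | i \in C) D C.

Definition outputs_cohort (R : realType) (n k : nat)
    (D : fdist R {set 'I_n}) : Prop :=
  forall C : {set 'I_n}, 0 < D C -> #|C| = k.

(* A rounding procedure is identified with the map sending its input to the
   law of its output; nothing is required on inputs outside the domain. *)
Definition dependent_rounding (R : realType) (n k : nat)
    (rnd : ('I_n -> R) -> fdist R {set 'I_n}) : Prop :=
  forall p : 'I_n -> R,
    (forall i, 0 <= p i <= 1) -> \sum_i p i = k%:R ->
    outputs_cohort k (rnd p) /\ forall i, selection_prob (rnd p) i = p i.

(* A relation, not a function: the shift b is any value meeting the
   requirement. *)
Definition offline_marginals (R : realType) (n k : nat)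
    (s p : 'I_n -> R) : Prop :=
  let S := \sum_i s i in
  [/\ S = k%:R -> forall i, p i = s i,
      S < k%:R -> exists b : R,
        [/\ 0 <= b, forall i, p i = Num.min (s i + b) 1
          & \sum_i p i = k%:R]
    & k%:R < S -> exists b : R,
        [/\ 0 <= b, forall i, p i = Num.max (s i - b) 0
          & \sum_i p i = k%:R]].

Definition fairness_preserving (R : realType) (n : nat)
    (s p : 'I_n -> R) : Prop :=
  forall i j, `|p i - p j| <= `|s i - s j|.

Definition linear_utility (R : realType) (n : nat) (s p : 'I_n -> R) : R :=
  \sum_i p i * s i.

Definition feasible (R : realType) (n k : nat) (s : 'I_n -> R) :
    set ('I_n -> R) :=
  [set q | [/\ forall i, 0 <= q i <= 1,
               \sum_i q i = k%:R
             & fairness_preserving s q]].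

Definition is_max (R : realType) (A : set R) (x : R) : Prop :=
  A x /\ ubound A x.

(* Main.v *)
(** Rounding: if [p] is not yet integral, integrality of its sum yields two
    fractional coordinates [i] and [j]; pushing mass from [j] to [i], or from
    [i] to [j], until one of them hits 0 or 1 writes [p] as a convex combination
    of two admissible vectors with fewer fractional coordinates.

    Optimality: if [q] is feasible, [p i < q i] and [q j < p j], then [p i < 1]
    and [0 < p j], so [p i - p j >= s i - s j]; were [s i > s j], fairness of
    [q] would be violated.  Hence some threshold [t] separates the scores of
    the candidates losing mass from those gaining it when [q] is replaced by
    [p], and since [\sum_i (p i - q i) = 0], the gain in utility is
    [\sum_i (p i - q i) * (s i - t) >= 0]. *)
Require Import Defs.
From HB Require Import structures.
From mathcomp Require Import all_boot all_order all_algebra.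
From mathcomp Require Import ring lra.
From mathcomp Require Import boolp classical_sets reals.
From mathcomp Require Import topology normedtype realfun.
Import Order.TTheory GRing.Theory Num.Theory.
Import numFieldNormedType.Exports.
Local Open Scope ring_scope.
Local Open Scope classical_set_scope.

(** * Point masses and mixtures of finite laws *)

Section FiniteDistributions.
Context {R : realType} {T : finType}.

Lemma fdist_dirac_ge0 (a x : T) : 0 <= [ffun y => (y == a)%:R : R] x.
Proof. by rewrite ffunE ler0n. Qed.

Lemma fdist_dirac_sum1 (a : T) : \sum_x [ffun y => (y == a)%:R : R] x = 1.
Proof.
rewrite (bigD1 a) //= ffunE eqxx big1 ?addr0// => x /negPf xa.
by rewrite ffunE xa.
Qed.

Definition fdist_dirac (a : T) : fdist R T :=
  FDist (fdist_dirac_ge0 a) (fdist_dirac_sum1 a).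

Context {w : R} (w01 : 0 <= w <= 1) (D1 D2 : fdist R T).

Lemma fdist_mix_ge0 x : 0 <= [ffun y => w * D1 y + (1 - w) * D2 y] x.
Proof.
case/andP: w01 => w0 w1.
by rewrite ffunE addr_ge0 ?mulr_ge0 ?pmf_ge0 ?subr_ge0.
Qed.

Lemma fdist_mix_sum1 : \sum_x [ffun y => w * D1 y + (1 - w) * D2 y] x = 1.
Proof.
under eq_bigr do rewrite ffunE.
by rewrite big_split /= -!mulr_sumr !pmf_sum1 !mulr1 addrC subrK.
Qed.

Definition fdist_mix : fdist R T := FDist fdist_mix_ge0 fdist_mix_sum1.

End FiniteDistributions.

(** * Existence of dependent rounding *)

Section Cohorts.
Context {R : realType} {n : nat}.
Implicit Types (C : {set 'I_n}) (D : fdist R {set 'I_n}) (p : 'I_n -> R).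

Lemma outputs_cohort_dirac C : outputs_cohort #|C| (fdist_dirac (R := R) C).
Proof. by move=> B; rewrite /= ffunE; case: eqP => [->|]; rewrite ?ltxx. Qed.

Lemma selection_prob_dirac C i :
  selection_prob (fdist_dirac (R := R) C) i = (i \in C)%:R.
Proof.
rewrite /selection_prob /=; under eq_bigr do rewrite ffunE.
have [iC|iC] := boolP (i \in C).
  by rewrite (bigD1 C) //= eqxx big1 ?addr0// => B /andP[_ /negPf ->].
by rewrite big1// => B iB; case: eqP => // BC; rewrite BC (negPf iC) in iB.
Qed.

Lemma outputs_cohort_mix (w : R) (w01 : 0 <= w <= 1) k D1 D2 :
  outputs_cohort k D1 -> outputs_cohort k D2 ->
  outputs_cohort k (fdist_mix w01 D1 D2).
Proof.
move=> h1 h2 C; rewrite /= ffunE => D0.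
have [/h1//|D1C] := ltP 0 (D1 C); have [/h2//|D2C] := ltP 0 (D2 C).
case/andP: w01 => w0 w1; move: D0; rewrite ltNge -[X in _ <= X]addr0.
by rewrite lerD ?mulr_ge0_le0 ?subr_ge0.
Qed.

Lemma selection_prob_mix (w : R) (w01 : 0 <= w <= 1) D1 D2 i :
  selection_prob (fdist_mix w01 D1 D2) i =
  w * selection_prob D1 i + (1 - w) * selection_prob D2 i.
Proof.
rewrite /selection_prob !mulr_sumr -big_split /=.
by apply: eq_bigr => C _; rewrite ffunE.
Qed.

Definition fractional p := [set i | 0 < p i < 1]%SET.

Lemma nonfractionalE p i : 0 <= p i <= 1 -> i \notin fractional p ->
  p i = (p i == 1)%:R.
Proof.
case/andP=> p0 p1; rewrite inE; case: eqP => [->//|/eqP pi1].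
rewrite [p i < 1]lt_neqAle pi1 p1 !andbT -leNgt => pi0.
by apply/eqP; rewrite eq_le p0 pi0.
Qed.

(** If [i] were the only fractional coordinate, the others would sum to a natural number [m], and
    [0 < p i < 1] would force [m < k < m + 1]. *)
Lemma fractional_pair p k i :
  (forall j, 0 <= p j <= 1) -> \sum_j p j = k%:R -> i \in fractional p ->
  exists2 j, j != i & j \in fractional p.
Proof.
move=> p01 psum ifr; apply: contrapT => nofr.
have pE j : j != i -> p j = (p j == 1)%:R.
  move=> ji; apply: nonfractionalE => //; apply/negP => jfr.
  by apply: nofr; exists j.
move: psum; rewrite (bigD1 i)//= (eq_bigr _ pE) -natr_sum.
set m := (\sum_(j | _) _)%N => psum.
move: ifr; rewrite inE => /andP[pi0 pi1].
have : (m%:R : R) < k%:R by lra.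
have : (k%:R : R) < m.+1%:R by rewrite -natr1; lra.
by rewrite !ltr_nat ltnS leqNgt => /negPf ->.
Qed.

Definition transfer p (i j : 'I_n) (c : R) (x : 'I_n) : R :=
  p x + c * ((x == i)%:R - (x == j)%:R).

Lemma sum_transfer p i j c : \sum_x transfer p i j c x = \sum_x p x.
Proof.
have sum_eq (a : 'I_n) : \sum_x ((x == a)%:R : R) = 1.
  by rewrite (bigD1 a)//= eqxx big1 ?addr0// => x /negPf ->.
by rewrite big_split /= -mulr_sumr sumrB !sum_eq subrr mulr0 addr0.
Qed.

Lemma transfer_saturate p i j :
  (forall x, 0 <= p x <= 1) -> i != j ->
  i \in fractional p -> j \in fractional p ->
  exists c : R, [/\ 0 < c, forall x, 0 <= transfer p i j c x <= 1
    & (#|fractional (transfer p i j c)| < #|fractional p|)%N].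
Proof.
move=> p01 ij ifr jfr.
move: (ifr) (jfr); rewrite !inE => /andP[pi0 pi1] /andP[pj0 pj1].
(* The largest transfer keeping both coordinates in the unit interval: either [i] reaches 1 or [j]
   reaches 0. *)
pose c := Num.min (1 - p i) (p j).
have ti : transfer p i j c i = p i + c.
  by rewrite /transfer eqxx (negPf ij) subr0 mulr1.
have tj : transfer p i j c j = p j - c.
  by rewrite /transfer eqxx [j == i]eq_sym (negPf ij) sub0r mulrN1.
have tx x : x != i -> x != j -> transfer p i j c x = p x.
  by move=> /negPf xi /negPf xj; rewrite /transfer xi xj subrr mulr0 addr0.
have c0 : 0 < c by rewrite lt_min pj0 subr_gt0 pi1.
have ci : c <= 1 - p i by rewrite ge_min lexx.
have cj : c <= p j by rewrite ge_min lexx orbT.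
exists c; split=> [//|x|].
  have [->|xi] := eqVneq x i; first by rewrite ti; apply/andP; split; lra.
  have [->|xj] := eqVneq x j; first by rewrite tj; apply/andP; split; lra.
  by rewrite tx.
(* Only [i] and [j] change, and both were fractional, so no new fractional coordinate appears; the
   one attaining the minimum drops out. *)
apply: proper_card; apply/properP; split.
  apply/fintype.subsetP => x.
  have [->//|xi] := eqVneq x i; have [->//|xj] := eqVneq x j.
  by rewrite !inE tx.
have [le|le] := leP (1 - p i) (p j).
  exists i => //; rewrite inE ti; have -> : c = 1 - p i by apply/min_idPl.
  by rewrite [p i + _]addrC subrK ltxx andbF.
exists j => //; rewrite inE tj; have -> : c = p j by apply/min_idPr/ltW.
by rewrite subrr ltxx.
Qed.

Lemma cohort_law_exists k p :
  (forall i, 0 <= p i <= 1) -> \sum_i p i = k%:R ->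
  exists D, outputs_cohort k D /\ forall i, selection_prob D i = p i.
Proof.
have [m] := ubnP #|fractional p|; elim: m p => // m IHm p + p01 psum.
(* With no fractional coordinate, [p] is the indicator of a set [C], and its sum gives [#|C| = k],
   so a point mass suffices. *)
have [fr0 _|[i ifr]] := set_0Vmem (fractional p).
  pose C := [set i | p i == 1]%SET.
  have pE i : p i = (i \in C)%:R by rewrite inE -nonfractionalE ?fr0 ?inE.
  have <- : #|C| = k.
    apply/eqP; rewrite -(eqr_nat R) -psum -sum1_card natr_sum big_mkcond /=.
    by apply/eqP/eq_bigr => i _; rewrite pE; case: (i \in C).
  exists (fdist_dirac C); split; first exact: outputs_cohort_dirac.
  by move=> i; rewrite selection_prob_dirac pE.
have [j ji jfr] := fractional_pair _ _ _ p01 psum ifr.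
rewrite ltnS => frm.
have ij : i != j by rewrite eq_sym.
have [a [a0 a01 afr]] := transfer_saturate _ _ _ p01 ij ifr jfr.
have [b [b0 b01 bfr]] := transfer_saturate _ _ _ p01 ji jfr ifr.
have [|||D1 [co1 sel1]] := IHm (transfer p i j a) => //.
- exact: leq_trans afr frm.
- by rewrite sum_transfer.
have [|||D2 [co2 sel2]] := IHm (transfer p j i b) => //.
- exact: leq_trans bfr frm.
- by rewrite sum_transfer.
have ab0 : 0 < a + b by rewrite addr_gt0.
(* With this weight the two opposite transfers cancel on average: [b * a - a * b = 0]. *)
have w01 : 0 <= b / (a + b) <= 1.
  by rewrite ler_pdivrMr// mul1r lerDr divr_ge0 ltW.
exists (fdist_mix w01 D1 D2); split; first exact: outputs_cohort_mix.
move=> x; rewrite selection_prob_mix sel1 sel2 /transfer.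
have : a + b != 0 by rewrite gt_eqF.
by move=> ?; field.
Qed.

Lemma dependent_rounding_exists k : (k <= n)%N ->
  exists rnd : ('I_n -> R) -> fdist R {set 'I_n}, dependent_rounding k rnd.
Proof.
move=> kn.
have law p : exists D, (forall i, 0 <= p i <= 1) -> \sum_i p i = k%:R ->
    outputs_cohort k D /\ forall i, selection_prob D i = p i.
  have [[p01 psum]|np] :=
      pselect ((forall i, 0 <= p i <= 1) /\ \sum_i p i = k%:R).
    by have [D Dp] := cohort_law_exists _ _ p01 psum; exists D.
  (* Outside the domain any law will do. *)
  by exists (fdist_dirac finset.set0) => p01 psum; case: np.
by exists (fun p => projT1 (cid (law p))) => p; exact: projT2 (cid (law p)).
Qed.

End Cohorts.

(** * Existence, feasibility and optimality of the offline marginals *)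

Section OfflineAlgorithm.
Context {R : realType} {n k : nat} {s : 'I_n -> R}.
Context (s01 : forall i : 'I_n, 0 <= s i <= 1).

(** Intermediate value theorem: the clipped sum is continuous in [b] and goes from [\sum_i s i] at 0
    to [n] at 1. *)
Lemma shift_up_exists : (k <= n)%N -> \sum_i s i <= k%:R ->
  exists2 b : R, 0 <= b & \sum_i Num.min (s i + b) 1 = k%:R.
Proof.
move=> kn Sk; pose f (b : R) := \sum_i Num.min (s i + b) 1.
have f0 : f 0 = \sum_i s i.
  apply: eq_bigr => i _; rewrite addr0; apply/min_idPl.
  by have /andP[] := s01 i.
have f1 : f 1 = n%:R.
  rewrite -[in RHS](card_ord n) -sum1_card natr_sum; apply: eq_bigr => i _.
  by apply/min_idPr; rewrite lerDr; have /andP[] := s01 i.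
have cf : continuous f.
  apply: continuous_big => [|i _ b]; first exact: add_continuous.
  apply: continuous_min; last exact: cvg_cst.
  by apply: cvgD; [exact: cvg_cst|exact: cvg_id].
have [|b + fb] := IVT ler01 (continuous_subspaceT cf) (v := k%:R).
  by rewrite f0 f1 ge_min Sk le_max (_ : k%:R <= n%:R) ?orbT ?ler_nat.
by rewrite in_itv /= => /andP[b0 _]; exists b.
Qed.

(** Same argument, with the sum going from [\sum_i s i] at 0 down to 0 at 1. *)
Lemma shift_down_exists : k%:R <= \sum_i s i ->
  exists2 b : R, 0 <= b & \sum_i Num.max (s i - b) 0 = k%:R.
Proof.
move=> kS; pose f (b : R) := \sum_i Num.max (s i - b) 0.
have f0 : f 0 = \sum_i s i.
  apply: eq_bigr => i _; rewrite subr0; apply/max_idPl.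
  by have /andP[] := s01 i.
have f1 : f 1 = 0.
  rewrite [LHS]big1// => i _.
  by apply/max_idPr; rewrite subr_le0; have /andP[] := s01 i.
have cf : continuous f.
  apply: continuous_big => [|i _ b]; first exact: add_continuous.
  apply: (continuous_max (f := fun c => s i - c) (g := fun=> 0));
    last exact: cvg_cst.
  by apply: cvgB; [exact: cvg_cst|exact: cvg_id].
have [|b + fb] := IVT ler01 (continuous_subspaceT cf) (v := k%:R).
  by rewrite f0 f1 ge_min ler0n orbT le_max kS.
by rewrite in_itv /= => /andP[b0 _]; exists b.
Qed.

Lemma offline_marginals_exists : (k <= n)%N ->
  exists p : 'I_n -> R, offline_marginals k s p.
Proof.
move=> kn; have [Sk|kS|Sk] := ltgtP (\sum_i s i) k%:R.
- have [b b0 sumb] := shift_up_exists kn (ltW Sk).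
  exists (fun i => Num.min (s i + b) 1); split=> [|_|]; last 1 first.
  + by rewrite ltNge (ltW Sk).
  + by move=> SE; rewrite SE ltxx in Sk.
  + by exists b.
- have [b b0 sumb] := shift_down_exists (ltW kS).
  exists (fun i => Num.max (s i - b) 0); split=> [||_].
  + by move=> SE; rewrite SE ltxx in kS.
  + by rewrite ltNge (ltW kS).
  + by exists b.
- by exists s; split; rewrite ?Sk ?ltxx.
Qed.

Context {p : 'I_n -> R}.

(** A common shift preserves differences of scores, and clipping never enlarges them. *)
Lemma offline_marginals_feasible :
  offline_marginals k s p -> feasible k s p.
Proof.
have dist i j : s i - s j <= `|s i - s j| /\ s j - s i <= `|s i - s j|.
  by rewrite ler_norm distrC ler_norm.
case; have [Sk|kS|Sk] := ltgtP (\sum_i s i) k%:R.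
- move=> _ /(_ isT)[b [b0 pE sumb]] _; split=> // [i|i j]; rewrite !pE.
  + by have /andP[? ?] := s01 i; case: (leP (s i + b) 1) => *;
      apply/andP; split; lra.
  + rewrite ler_norml; have [? ?] := dist i j.
    by case: (leP (s i + b) 1) => ?; case: (leP (s j + b) 1) => *;
      apply/andP; split; lra.
- move=> _ _ /(_ isT)[b [b0 pE sumb]]; split=> // [i|i j]; rewrite !pE.
  + by have /andP[? ?] := s01 i; case: (leP (s i - b) 0) => *;
      apply/andP; split; lra.
  + rewrite ler_norml; have [? ?] := dist i j.
    by case: (leP (s i - b) 0) => ?; case: (leP (s j - b) 0) => *;
      apply/andP; split; lra.
- move=> /(_ Sk) pE _ _; split=> [i||i j]; rewrite ?pE//.
  by rewrite -Sk; exact: eq_bigr.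
Qed.

(** For an upward shift, [p i < 1] means [i] is unclipped, while clipping can only lower [p j]. For
    a downward shift, [0 < p j] means [j] is unclipped, while clipping can only raise [p i]. *)
Lemma offline_marginals_spread i j : offline_marginals k s p ->
  p i < 1 -> 0 < p j -> s i - s j <= p i - p j.
Proof.
case; have [Sk|kS|Sk] := ltgtP (\sum_i s i) k%:R.
- move=> _ /(_ isT)[b [b0 pE _]] _; rewrite !pE.
  by case: (leP (s i + b) 1) => ?; case: (leP (s j + b) 1) => *; lra.
- move=> _ _ /(_ isT)[b [b0 pE _]]; rewrite !pE.
  by case: (leP (s i - b) 0) => ?; case: (leP (s j - b) 0) => *; lra.
- by move=> /(_ Sk) pE _ _; rewrite !pE.
Qed.

Lemma offline_marginals_optimal q : offline_marginals k s p ->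
  feasible k s q -> linear_utility s q <= linear_utility s p.
Proof.
move=> offp [q01 qsum qfair].
have [p01 psum _] := offline_marginals_feasible offp.
have separated i j : p i < q i -> q j < p j -> s i <= s j.
  move=> pqi qpj; rewrite leNgt; apply/negP => sji.
  have /andP[_ qi1] := q01 i; have /andP[qj0 _] := q01 j.
  (* If [s j < s i], then [s i - s j <= p i - p j < q i - q j <= s i - s j], which is absurd. *)
  have := offline_marginals_spread _ _ offp (lt_le_trans pqi qi1)
    (le_lt_trans qj0 qpj).
  have := le_trans (ler_norm _) (qfair i j).
  by rewrite [X in _ <= X]gtr0_norm ?subr_gt0//; lra.
(* The threshold is the top score among candidates that [q] favours. The default 0 is harmless
   because scores are nonnegative. *)
pose t := \big[Num.max/0]_(i | p i < q i) s i.
have gain i : 0 <= (p i - q i) * (s i - t).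
  have [pqi|qpi|->] := ltgtP (p i) (q i); last by rewrite subrr mul0r.
  - by rewrite mulr_le0// subr_le0 ?(ltW pqi)// le_bigmax_cond.
  - rewrite mulr_ge0// subr_ge0 ?(ltW qpi)//; apply: bigmax_le => [|j pqj].
      by have /andP[] := s01 i.
    exact: separated.
rewrite -subr_ge0; suff -> : linear_utility s p - linear_utility s q =
    \sum_i (p i - q i) * (s i - t) by exact: sumr_ge0.
(* The [t] terms vanish since [p] and [q] both sum to [k]. *)
under [RHS]eq_bigr do rewrite mulrBr.
rewrite sumrB -mulr_suml sumrB psum qsum subrr mul0r subr0 /linear_utility.
by rewrite -sumrB; apply: eq_bigr => i _; rewrite mulrBl.
Qed.

End OfflineAlgorithm.

(** The two existence claims keep the universally quantified one from being vacuous. *)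
Theorem theorem1 (R : realType) (n k : nat) (s : 'I_n -> R)
    (k_ge1 : (1 <= k)%N) (k_le_n : (k <= n)%N)
    (s01 : forall i : 'I_n, 0 <= s i <= 1) :
  (exists rnd : ('I_n -> R) -> fdist R {set 'I_n}, dependent_rounding k rnd) /\
  (exists p : 'I_n -> R, offline_marginals k s p) /\
  (forall (rnd : ('I_n -> R) -> fdist R {set 'I_n}) (p : 'I_n -> R),
     dependent_rounding k rnd -> offline_marginals k s p ->
     [/\ outputs_cohort k (rnd p),
         forall i : 'I_n, selection_prob (rnd p) i = p i,
         fairness_preserving s p
       & is_max [set linear_utility s q | q in feasible k s]
                (linear_utility s p)]).
Proof.
split; first exact: dependent_rounding_exists.
split; first exact: offline_marginals_exists s01 k_le_n.
move=> rnd p rndk offp; have feas := offline_marginals_feasible s01 offp.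
have [p01 psum fair] := feas; have [cohort marg] := rndk p p01 psum.
split=> //; split; first by exists p.
by move=> _ [q feasq <-]; exact: (offline_marginals_optimal s01 _ offp feasq).
Qed.
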